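(* Let $X,Y$ be locally compact Hausdorff spaces, $p\colon X\to Y$ a continuous proper map, and $\mu_X$ a positive Radon measure on $X$. Let $A$ be a dense $\mathbb{C}$-subalgebra of $C_0(Y)$, and let $M\subset C_0(X)\cap\mathcal{L}^1(X,\mu_X)$ be a $p^*A$-module under pointwise multiplication such that: (1) $M$ is stable under pointwise complex conjugation; (2) for every $y\in Y$, the set of restrictions of elements of $M$ to $p^{-1}(y)$ is dense in $C(p^{-1}(y))$; (3) for every $m\in M$ there exists $n\in M$ with $|m|\le n$. Then $\mathcal{RI}(X,\mu_X)\subset\overline{M}^{\tau_M}$; that is, for every $\mu_X$-Riemann integrable $\phi$ and every $\epsilon>0$ there exist $m_1,m_2\in \overline{M}^{\tau_M}$ (equivalently in $M$) with $|\phi-m_1|\le m_2$ and $\mu_X(m_2)<\epsilon$.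
   Context: $p^*A=\{a\circ p: a\in A\}$. A function $\phi\colon X\to\mathbb{C}$ is $\mu_X$-Riemann integrable if it is bounded, compactly supported, and its set of discontinuity points is $\mu_X$-null; $\mathcal{RI}(X,\mu_X)$ is the set of such functions. For a linear subspace $M\subset\mathcal{L}^1(X,\mu_X)$ stable under complex conjugation, $\overline{M}^{\tau_M}$ denotes the set of $h\in\mathcal{L}^1(X,\mu_X)$ such that for every $\epsilon>0$ there exist $m_1,m_2\in M$ with $|h-m_1|\le m_2$ pointwise and $\mu_X(m_2)<\epsilon$. *)

(* Defs.v *)
(* Complex numbers: mathcomp-real-closed's R[i],
   viewed through ^o to get its canonical normed (hence topological) structure. *)
From mathcomp Require Import complex.
From mathcomp Require Import all_boot all_algebra.
From mathcomp Require Import all_classical all_reals all_analysis.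
Import numFieldNormedType.Exports.
Import GRing.Theory Num.Theory.
Set Implicit Arguments. Unset Strict Implicit. Unset Printing Implicit Defensive.
Local Open Scope classical_set_scope.
Local Open Scope ring_scope.
Local Open Scope complex_scope.

Notation Cx R := ((complex R)^o).

(* The Borel sigma-algebra on a topological space X (generated by the opens);
   its carrier is X itself. *)
Notation Borel X := (g_sigma_algebraType (@open X)).

Definition proper_map (X Y : topologicalType) (p : X -> Y) :=
  forall K : set Y, compact K -> compact (p @^-1` K).

Definition C0 (R : realType) (X : topologicalType) (f : X -> Cx R) :=
  continuous f /\
  forall e : R, 0 < e -> compact [set x | e%:C <= `|f x| ].

Definition dense_subalgebra_C0 (R : realType) (Y : topologicalType)
    (A : set (Y -> Cx R)) :=
  [/\ A `<=` C0 (R := R) (X := Y),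
      A (fun _ => 0),
      (forall a b, A a -> A b -> A (fun y => a y + b y)) &
      (forall (c : Cx R) a, A a -> A (fun y => c * a y))] /\
  [/\ (forall a b, A a -> A b -> A (fun y => a y * b y)) &
      (forall f, C0 f -> forall e : R, 0 < e ->
         exists2 a, A a & forall y, `|f y - a y| <= e%:C)].

Definition radon_measure (R : realType) (X : ptopologicalType)
    (mu : {measure set (Borel X) -> \bar R}) :=
  [/\ (forall K : set X, compact K -> (mu K < +oo)%E),
      (forall E : set (Borel X), measurable E ->
         mu E = ereal_inf [set mu U | U in [set U : set X | open U /\ E `<=` U]]) &
      (forall U : set X, open U ->
         mu U = ereal_sup [set mu K | K in [set K : set X | compact K /\ K `<=` U]])].

Definition cintegrable (R : realType) (X : ptopologicalType)
    (mu : {measure set (Borel X) -> \bar R}) (f : X -> Cx R) :=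
  mu.-integrable [set: Borel X] (fun x => (complex.Re (f x))%:E) /\
  mu.-integrable [set: Borel X] (fun x => (complex.Im (f x))%:E).

(* L^1(X, mu_X) (w.r.t. the completed measure): functions that coincide
   mu-almost everywhere with an integrable Borel function. *)
Definition L1 (R : realType) (X : ptopologicalType)
    (mu : {measure set (Borel X) -> \bar R}) (f : X -> Cx R) :=
  exists g : X -> Cx R, cintegrable mu g /\
    {ae mu, forall x : Borel X, f x = g x}.

Definition cint (R : realType) (X : ptopologicalType)
    (mu : {measure set (Borel X) -> \bar R}) (f : X -> Cx R) : Cx R :=
  (Rintegral mu [set: Borel X] (fun x => complex.Re (f x)))%:C +
  'i * (Rintegral mu [set: Borel X] (fun x => complex.Im (f x)))%:C.

Definition riemann_integrable (R : realType) (X : ptopologicalType)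
    (mu : {measure set (Borel X) -> \bar R}) (phi : X -> Cx R) :=
  [/\ (exists B : R, forall x, `|phi x| <= B%:C),
      compact (closure [set x | phi x != 0]) &
      mu.-negligible [set x : Borel X | ~ {for x, continuous phi}]].

Definition tau_closure (R : realType) (X : ptopologicalType)
    (mu : {measure set (Borel X) -> \bar R}) (M : set (X -> Cx R))
    (h : X -> Cx R) :=
  L1 mu h /\
  forall e : R, 0 < e -> exists m1 m2, [/\ M m1, M m2,
     (forall x, `|h x - m1 x| <= m2 x) & cint mu m2 < e%:C].

(* Main.v *)
(* A Riemann integrable [phi] with support in a compact [K] is first compared
   with continuous functions.  The discontinuities of [phi] lie in an open set
   [U] of small measure; cover [K] by [U] and by neighbourhoods of the points
   outside [U] on which [phi] varies by less than [eta], and take a partition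
   of unity [chi_i] with centers [x_i].  Then [f = sum chi_i phi(x_i)]
   satisfies [|phi - f| <= g] with [g] continuous, compactly supported and of
   small integral.

   It remains to approximate a continuous compactly supported [f] from [M].
   As [p] is proper, an element of [M] close to [f] on the fiber over [y] is
   close to [f] on all fibers near [y]; a partition of unity on [Y], whose
   members are then approximated by elements of [A], glues these local
   approximations into an element of [M]. *)
From HB Require Import structures.
Require Import Defs.
From mathcomp Require Import complex.
From mathcomp Require Import all_boot all_order all_algebra finmap.
From mathcomp Require Import all_classical all_reals all_analysis.
From mathcomp Require Import measurable_realfun lra.
Set Implicit Arguments. Unset Strict Implicit. Unset Printing Implicit Defensive.
Import numFieldNormedType.Exports.
Import Order.TTheory GRing.Theory Num.Theory.
Local Open Scope classical_set_scope.
Local Open Scope ring_scope.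
Local Open Scope complex_scope.

(** * Compactness, partitions of unity and proper maps *)

Lemma locally_compact_nbhs (T : topologicalType) (x : T) :
  locally_compact [set: T] -> exists2 C, nbhs x C & compact C /\ closed C.
Proof.
move=> /(_ x I); by rewrite /= withinET.
Qed.

(** A point of [K] makes [T] a pointed space, as [compact_cover] requires; an empty [K] is covered
    by the empty family. *)
Lemma compact_cover_compact (T : topologicalType) (K : set T) :
  compact K -> cover_compact K.
Proof.
have [[x _]|nK _] := pselect (K !=set0); last first.
  by move=> I D f _ _; exists fset0 => // x Kx; case: nK; exists x.
pose T' : ptopologicalType := HB.pack T (isPointed.Build T x).
by move=> cK; have : (@cover_compact T') K by rewrite -compact_cover.
Qed.

(** Locally compact Hausdorff spaces are completely regular: [u] is one minus a Urysohn function
    separating [x] from the complement of the interior of [V]. *)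
Lemma locally_compact_bump (R : realType) (T : topologicalType) (x : T)
    (V : set T) :
  hausdorff_space T -> locally_compact [set: T] -> nbhs x V ->
  exists u : T -> R, [/\ continuous u, (forall z, 0 <= u z), u x = 1 &
    forall z, u z != 0 -> V z].
Proof.
move=> hT lT xV; pose B := ~` V°.
have sep : @uniform_separator T [set x] B.
  apply: (@locally_compact_completely_regular T R) => //.
  by rewrite /B closedC; exact: open_interior.
have u0 := Urysohn_sub0 (R := R) sep; have u1 := Urysohn_sub1 (R := R) sep.
exists (fun z => 1 - Urysohn [set x] B z); split.
- move=> z; apply: cvgB; first exact: cvg_cst.
  exact: Urysohn_continuous.
- move=> z; have := @Urysohn_range T R [set x] B (Urysohn [set x] B z).
  by move=> /(_ (ex_intro2 _ _ z I erefl)) /=; rewrite in_itv /= subr_ge0 => /andP[].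
- by have /= := u0 _ (ex_intro2 _ _ x erefl erefl); move=> ->; rewrite subr0.
- move=> z; apply: contra_neqP => nVz; have /= -> := u1 (Urysohn [set x] B z).
    by rewrite subrr.
  by exists z => // /interior_subset.
Qed.

(* The bumps [u i] are divided by [max (sum u) (1/2)] rather than by their sum,
   which may vanish away from [K]. *)
Lemma compact_partition_of_unity (R : realType) (T : topologicalType)
    (K : set T) (V : T -> set T) :
  hausdorff_space T -> locally_compact [set: T] -> compact K ->
  (forall x, K x -> nbhs x (V x)) ->
  exists (D : {fset T}) (chi : T -> T -> R),
    [/\ (forall i, i \in D -> K i), (forall i, continuous (chi i)),
        (forall i z, 0 <= chi i z) & (forall i z, chi i z != 0 -> V i z)] /\
    [/\ (forall z, \sum_(i <- D) chi i z <= 1) &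
        (forall z, K z -> \sum_(i <- D) chi i z = 1)].
Proof.
move=> hT lT cK KV.
have /choice[u uP] : forall x, exists u : T -> R, [/\ continuous u,
    (forall z, 0 <= u z), K x -> u x = 1 & forall z, u z != 0 -> V x z].
  move=> x; have [Kx|nKx] := pselect (K x).
    by have [u [? ? ? ?]] := locally_compact_bump R hT lT (KV x Kx); exists u.
  exists (fun=> 0); split => //; first by move=> ?; exact: cvg_cst.
  by move=> z; rewrite eqxx.
have uc x : continuous (u x) by have [] := uP x.
have u_ge0 x z : 0 <= u x z by have [] := uP x.
have := compact_cover_compact cK.
(* The threshold 1/2 forces [s] above 1/2 on [K], so that [w] is the sum [s] itself there. *)
move=> /(_ T K (fun x => [set z | 2^-1 < u x z])) [| |D DK Dcov].
- move=> x Kx; apply: (open_comp (f := u x) (D := [set r | 2^-1 < r])).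
    by move=> z _; exact: uc.
  exact: open_gt.
- move=> x Kx; exists x => //=; have [_ _ -> // _] := uP x.
  by rewrite invf_lt1 ?ltr1n.
pose s z := \sum_(i <- D) u i z.
have sc : continuous s.
  by apply: continuous_big => //; exact: add_continuous.
pose w z := Num.max (s z) 2^-1.
have w_gt0 z : 0 < w z by rewrite /w lt_max invr_gt0 ltr0n orbT.
exists D, (fun i z => u i z / w z); split; split.
- by move=> i /DK; rewrite inE.
- move=> i z; apply: cvgM; first exact: uc.
  apply: cvgV; first by rewrite gt_eqF.
  apply: continuous_max; [exact: sc|exact: cvg_cst].
- by move=> i z; rewrite divr_ge0 // ltW.
- move=> i z uz; have [_ _ _] := uP i; apply.
  by apply: contra_neq uz => ->; rewrite mul0r.
- move=> z; rewrite -mulr_suml ler_pdivrMr // mul1r.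
  by rewrite /w le_max lexx.
- move=> z Kz; rewrite -mulr_suml -/(s z).
  have [i /= iD ui] := Dcov z Kz.
  have sz : 2^-1 < s z.
    apply: (lt_le_trans ui); rewrite /s (big_fsetD1 i) //= lerDl.
    exact: sumr_ge0.
  by rewrite /w max_l ?ltW// divff // gt_eqF // (lt_trans _ sz) // invr_gt0.
Qed.

(** For a compact neighbourhood [C] of [y], the part of its preimage outside [W] is compact, so its
    image is closed. This image misses [y], and the points of [C] off it have their fibers in
    [W]. *)
Lemma proper_map_fiber_nbhs (X Y : topologicalType) (p : X -> Y) (y : Y)
    (W : set X) :
  hausdorff_space Y -> locally_compact [set: Y] ->
  continuous p -> proper_map p -> open W -> p @^-1` [set y] `<=` W ->
  nbhs y [set z | p @^-1` [set z] `<=` W].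
Proof.
move=> hY lY cp pp oW yW.
have [C yC [cC _]] := locally_compact_nbhs y lY.
have cE : compact (p @^-1` C `&` ~` W).
  by apply: compact_closedI; [exact: pp|rewrite closedC].
have clE : closed (p @` (p @^-1` C `&` ~` W)).
  apply: compact_closed => //; apply: continuous_compact => //.
  exact: continuous_subspaceT.
have nyE : nbhs y (~` (p @` (p @^-1` C `&` ~` W))).
  apply: open_nbhs_nbhs; split; first by rewrite openC.
  by move=> [x [_ nWx] pxy]; exact/nWx/yW.
apply: filterS (filterI yC nyE) => z [Cz nEz] x /= pxz.
by apply: contrapT => nWx; apply: nEz; exists x => //; split => //=; rewrite pxz.
Qed.

(** * Moduli, real parts and continuity of complex-valued functions *)

Lemma normcR (R : realType) (r : R) : `|r%:C : Cx R| = `|r|%:C.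
Proof. by rewrite normc_def /= expr0n addr0 sqrtr_sqr. Qed.

Lemma normr_Re_le (R : realType) (z : Cx R) : `|complex.Re z|%:C <= `|z|.
Proof. by rewrite normc_def lecR -sqrtr_sqr ler_wsqrtr // lerDl sqr_ge0. Qed.

Lemma normr_Im_le (R : realType) (z : Cx R) : `|complex.Im z|%:C <= `|z|.
Proof. by rewrite normc_def lecR -sqrtr_sqr ler_wsqrtr // lerDr sqr_ge0. Qed.

Lemma RRe_norm (R : realType) (z : Cx R) : (complex.Re `|z|)%:C = `|z|.
Proof. by rewrite normc_def. Qed.

Lemma continuous_Re (R : realType) (T : topologicalType) (f : T -> Cx R) x :
  {for x, continuous f} -> {for x, continuous (fun z => complex.Re (f z))}.
Proof.
move=> /cvgrPdist_lt fc; apply/cvgrPdist_lt => e e0.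
have := fc e%:C; rewrite ltcR => /(_ e0); apply: filterS => z.
rewrite -ltcR; apply: le_lt_trans.
by apply: le_trans (normr_Re_le _); case: (f x) (f z) => [a b] [c d].
Qed.

Lemma continuous_Im (R : realType) (T : topologicalType) (f : T -> Cx R) x :
  {for x, continuous f} -> {for x, continuous (fun z => complex.Im (f z))}.
Proof.
move=> /cvgrPdist_lt fc; apply/cvgrPdist_lt => e e0.
have := fc e%:C; rewrite ltcR => /(_ e0); apply: filterS => z.
rewrite -ltcR; apply: le_lt_trans.
by apply: le_trans (normr_Im_le _); case: (f x) (f z) => [a b] [c d].
Qed.

Lemma continuous_real_complex (R : realType) (T : topologicalType)
    (f : T -> R) x :
  {for x, continuous f} -> {for x, continuous (fun z => (f z)%:C : Cx R)}.
Proof.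
move=> /cvgrPdist_lt fc; apply/cvgrPdist_lt => e e0.
(* A positive element for the order of [Cx R] is real. *)
have eE : (complex.Re e)%:C = e by rewrite RRe_real // gtr0_real.
have := fc (complex.Re e); rewrite -ltcR eE => /(_ e0).
apply: filterS => z; rewrite -ltcR eE; apply: le_lt_trans.
by rewrite -rmorphB normcR.
Qed.

Lemma continuous_Re_normB (R : realType) (T : topologicalType)
    (f g : T -> Cx R) :
  continuous f -> continuous g ->
  continuous (fun x => complex.Re `|f x - g x|).
Proof.
move=> cf cg x; apply: (@continuous_Re _ _ (fun x => `|f x - g x|)).
by apply: cvg_norm; apply: cvgB; [exact: cf|exact: cg].
Qed.

Lemma open_normB_lt (R : realType) (T : topologicalType)
    (f g : T -> Cx R) (e : R) :
  continuous f -> continuous g -> open [set x | `|f x - g x| < e%:C].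
Proof.
move=> cf cg; have -> : [set x | `|f x - g x| < e%:C] =
    (fun x => complex.Re `|f x - g x|) @^-1` [set r | r < e].
  by apply/seteqP; split=> x /=; rewrite -RRe_norm ltcR.
by apply: open_comp; [move=> x _; exact: continuous_Re_normB|exact: open_lt].
Qed.

Lemma C0_real_complex (R : realType) (T : topologicalType) (f : T -> R)
    (C : set T) :
  continuous f -> compact C -> (forall x, f x != 0 -> C x) ->
  C0 (fun x => (f x)%:C : Cx R).
Proof.
move=> cf cC fC; split; first by move=> x; apply: continuous_real_complex; exact: cf.
move=> e e0; apply: (subclosed_compact _ cC) => [|x /=]; last first.
  rewrite normcR lecR => ef; apply: fC.
  by rewrite -normr_gt0 (lt_le_trans e0).
have -> : [set x | e%:C <= `|(f x)%:C : Cx R|] =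
    (fun x => `|f x|) @^-1` [set r | e <= r].
  by apply/seteqP; split=> x /=; rewrite normcR lecR.
by apply: closed_comp; [move=> x _; apply: cvg_norm; exact: cf|exact: closed_ge].
Qed.

Lemma closed_big_sum (R : realType) (X : Type) (M : set (X -> Cx R))
    (I : Type) (s : seq I) (F : I -> X -> Cx R) :
  M (fun _ => 0) -> (forall m n, M m -> M n -> M (fun x => m x + n x)) ->
  (forall i, M (F i)) -> M (fun x => \sum_(i <- s) F i x).
Proof.
move=> M0 MD MF; elim: s => [|i s IH].
  by under [fun x => _]eq_fun do rewrite big_nil.
by under [fun x => _]eq_fun do rewrite big_cons; exact: MD.
Qed.

Lemma real_complex1 (R : realType) : 1 = 1%:C :> Cx R. Proof. by []. Qed.

(** * Approximation of continuous functions from the module *)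

Section fiberwise_approximation.
Variables (R : realType) (X Y : topologicalType) (p : X -> Y).
Variables (A : set (Y -> Cx R)) (M : set (X -> Cx R)).
Hypothesis hausY : hausdorff_space Y.
Hypothesis lcY : locally_compact [set: Y].
Hypothesis p_cont : continuous p.
Hypothesis p_proper : proper_map p.
Hypothesis A_dense : dense_subalgebra_C0 A.
Hypothesis M_C0 : M `<=` C0 (R := R) (X := X).
Hypothesis M0 : M (fun _ => 0).
Hypothesis MD : forall m n, M m -> M n -> M (fun x => m x + n x).
Hypothesis MZ : forall (c : Cx R) m, M m -> M (fun x => c * m x).
Hypothesis MA : forall a m, A a -> M m -> M (fun x => a (p x) * m x).
Hypothesis M_fiber : forall (y : Y) (g : X -> Cx R),
  {within p @^-1` [set y], continuous g} ->
  forall e : R, 0 < e ->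
  exists2 m, M m & forall x, p x = y -> `|m x - g x| <= e%:C.
Hypothesis M_dom : forall m, M m -> exists2 n, M n & forall x, `|m x| <= n x.

(** Fiber density gives [m] within 1/2 of 1 on the fiber. A dominating [n] is at least 1/2 there,
    hence exceeds 1/4 on all nearby fibers by properness, and [4 * n] works. *)
Lemma module_ge1_near_fiber (y : Y) : exists n, [/\ M n, forall x, 0 <= n x &
  nbhs y [set z | p @^-1` [set z] `<=` [set x | 1 <= n x]]].
Proof.
have h2 : 0 < 2^-1 :> R by rewrite invr_gt0.
have [|m Mm m1] := @M_fiber y (fun=> 1) _ 2^-1 h2.
  by apply: continuous_subspaceT => x; exact: cvg_cst.
have [n Mn mn] := M_dom Mm.
have n_ge0 x : 0 <= n x by apply: le_trans (mn x).
have nE x : (complex.Re (n x))%:C = n x by rewrite RRe_real // ger0_real.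
have nc : continuous n by have [] := M_C0 Mn.
exists (fun x => 4 * n x); split; first exact: MZ.
  by move=> x; rewrite mulr_ge0.
pose W := (fun x => complex.Re (n x)) @^-1` [set r | 4^-1 < r].
have oW : open W.
  apply: open_comp; last exact: open_gt.
  by move=> x _; apply: continuous_Re; exact: nc.
apply: filterS (proper_map_fiber_nbhs hausY lcY p_cont p_proper oW _).
  move=> z zW x /zW; rewrite /W /= => n4.
  rewrite -nE -[4]/(4%:R) -(rmorph_nat (real_complex R)) -rmorphM /=.
  by rewrite real_complex1 lecR; lra.
move=> x /= pxy; have := m1 x pxy; rewrite distrC => m1x.
have : 2^-1%:C <= n x.
  apply: le_trans (mn x).
  have := ler_distD (m x) 1 0; rewrite !subr0 normr1 => h.
  have := le_trans h (lerD m1x (lexx _)).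
  rewrite -lerBlDl; apply: le_trans.
  by rewrite real_complex1 -rmorphB lecR; lra.
by rewrite /W /= -nE lecR; apply: lt_le_trans; lra.
Qed.

(** The functions of a finite subcover are nonnegative, so their sum keeps each lower bound 1.
    Neighbourhoods of the points of [K] matter because partition functions need not vanish off
    [K]. *)
Lemma module_ge1_near_compact (K : set Y) : compact K ->
  exists n, [/\ M n, forall x, 0 <= n x & forall y, K y ->
  nbhs y [set z | p @^-1` [set z] `<=` [set x | 1 <= n x]]].
Proof.
move=> cK; have /choice[n nP] := module_ge1_near_fiber.
pose V y := [set z | p @^-1` [set z] `<=` [set x | 1 <= n y x]].
have n_ge0 y x : 0 <= n y x by have [_ ->] := nP y.
have [||D _ DK] := compact_cover_compact cK (D := K) (f := fun y => (V y)°).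
- by move=> y _; exact: open_interior.
- by move=> y Ky; exists y => //; have [] := nP y.
exists (fun x => \sum_(i <- D) n i x); split.
- by apply: closed_big_sum => // i; have [] := nP i.
- by move=> x; apply: sumr_ge0.
move=> y Ky; have [i /= iD Viy] := DK y Ky.
apply: filterS Viy => z Viz x /Viz /= /le_trans; apply.
by rewrite (big_fsetD1 i) //= lerDl sumr_ge0.
Qed.

(* [n0] does not depend on [eta], and [n1] not on [d]: choosing [eta] and then
   [d] makes the integral of the error bound small. *)
Lemma module_approximation (f : X -> Cx R) (K : set X) :
  continuous f -> compact K -> (forall x, f x != 0 -> K x) ->
  exists n0, [/\ M n0, forall x, 0 <= n0 x & forall eta : R, 0 < eta ->
  exists n1, [/\ M n1, forall x, 0 <= n1 x & forall d : R, 0 < d ->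
  exists2 m, M m &
    forall x, `|f x - m x| <= eta%:C * n0 x + d%:C * n1 x]].
Proof.
move=> cf cK fK; pose K' := p @` K.
have cK' : compact K'.
  by apply: continuous_compact => //; exact: continuous_subspaceT.
have [n0 [Mn0 n0_ge0 n0K]] := module_ge1_near_compact cK'.
exists n0; split=> // eta eta0.
have /choice[m mP] : forall y : Y, exists m : X -> Cx R, M m /\ nbhs y
    [set z | p @^-1` [set z] `<=` [set x | `|f x - m x| < eta%:C]].
  move=> y; have eta2 : 0 < eta / 2 by rewrite divr_gt0.
  have [|m Mm fm] := @M_fiber y f _ (eta / 2) eta2.
    exact: continuous_subspaceT.
  exists m; split=> //; apply: proper_map_fiber_nbhs => //.
    by apply: open_normB_lt => //; have [] := M_C0 Mm.
  move=> x /= /fm; rewrite distrC => /le_lt_trans; apply.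
  by rewrite ltcR; lra.
have Mm y : M (m y) by have [] := mP y.
have /choice[n nP] : forall y : Y, exists n : X -> Cx R, M n /\ forall x, `|m y x| <= n x.
  by move=> y; have [n] := M_dom (Mm y); exists n.
have /choice[C CP] : forall y : Y, exists C, nbhs y C /\ compact C.
  by move=> y; have [C ? []] := locally_compact_nbhs y lcY; exists C.
(* The compact [C y] puts the partition functions in C0(Y); the condition [1 <= n0] turns the
   constant error [eta] into [eta * n0], which lies in [M]. *)
pose V y := C y `&` (
  [set z | p @^-1` [set z] `<=` [set x | `|f x - m y x| < eta%:C]] `&`
  [set z | p @^-1` [set z] `<=` [set x | 1 <= n0 x]]).
have [|D [chi [[DK' chic chi0 chiV] [chi1 chiK]]]] :=
    @compact_partition_of_unity R _ K' V hausY lcY cK'.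
  move=> y Ky; apply: filterI; first by have [] := CP y.
  by apply: filterI; [have [] := mP y|exact: n0K].
(* [n1] bounds the sum of the moduli of the [m i], so errors at most [d] in the coefficients cost at
   most [d * n1]; [D] and [m] are fixed before [d]. *)
exists (fun x => \sum_(i <- D) n i x); split.
- by apply: closed_big_sum => // i; have [] := nP i.
- by move=> x; apply: sumr_ge0 => i _; apply: le_trans (proj2 (nP i) x).
move=> d d0; have [_ [_ Ad]] := A_dense.
have /choice[a aP] : forall i : Y, exists a : Y -> Cx R, A a /\
    forall y, `|(chi i y)%:C - a y| <= d%:C.
  move=> i; have [|a Aa ad] := Ad (fun y => (chi i y)%:C : Cx R) _ d d0.
    by apply: (@C0_real_complex _ _ _ (C i)) => [||y /chiV[]//];
      [exact: chic|exact: (proj2 (CP i))].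
  by exists a.
exists (fun x => \sum_(i <- D) a i (p x) * m i x).
  by apply: closed_big_sum => // i; apply: MA; [exact: (proj1 (aP i))|].
move=> x.
pose S : Cx R := \sum_(i <- D) (chi i (p x))%:C.
have SE : S = (\sum_(i <- D) chi i (p x))%:C by rewrite /S rmorph_sum.
(* The partition sums to 1 at [p x] wherever [f x] is nonzero, so [f] distributes over it. The first
   sum is the local error, the second the cost of replacing each [chi i] by [a i]. *)
have -> : f x - \sum_(i <- D) a i (p x) * m i x =
    \sum_(i <- D) (chi i (p x))%:C * (f x - m i x) +
    \sum_(i <- D) ((chi i (p x))%:C - a i (p x)) * m i x.
  have Sf : S * f x = f x.
    have [->|fx0] := eqVneq (f x) 0; first by rewrite mulr0.
    by rewrite SE chiK ?mul1r //; exists x => //; exact: fK.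
  under [X in _ = X + _]eq_bigr do rewrite mulrBr; rewrite sumrB -mulr_suml -/S Sf.
  under [X in _ = _ + X]eq_bigr do rewrite mulrBl; rewrite sumrB.
  by rewrite addrA subrK.
apply: (le_trans (ler_normD _ _)); apply: lerD; last first.
  rewrite mulr_sumr; apply: (le_trans (ler_norm_sum _ _ _)).
  apply: ler_sum => i _; rewrite normrM; apply: ler_pM => //.
  - exact: (proj2 (aP i)).
  - exact: (proj2 (nP i)).
apply: (le_trans (ler_norm_sum _ _ _)).
apply: (@le_trans _ _ (S * (eta%:C * n0 x))).
  rewrite /S mulr_suml; apply: ler_sum => i _; rewrite normrM normcR.
  rewrite (ger0_norm (chi0 _ _)).
  have [->|/chiV [_ [/(_ x erefl) /= fm /(_ x erefl) /= n1]]] :=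
    eqVneq (chi i (p x)) 0; first by rewrite rmorph0 !mul0r.
  apply: ler_wpM2l; first by rewrite ler0c.
  by rewrite (le_trans (ltW fm)) // ler_peMr // ler0c ltW.
rewrite -[leRHS]mul1r; apply: ler_wpM2r.
  by rewrite mulr_ge0 // ler0c ltW.
by rewrite SE real_complex1 lecR.
Qed.

End fiberwise_approximation.

(** * Borel measurability and integrability *)

Lemma Borel_open (X : ptopologicalType) (U : set X) :
  open U -> measurable (U : set (Borel X)).
Proof. by move=> oU; exact: sub_sigma_algebra. Qed.

Lemma Borel_closed (X : ptopologicalType) (F : set X) :
  closed F -> measurable (F : set (Borel X)).
Proof.
move=> cF; rewrite -[F]setCK; apply: measurableC; apply: Borel_open.
by rewrite openC.
Qed.

Lemma Borel_measurable_lsc (R : realType) (X : ptopologicalType) (f : X -> R) :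
  (forall a, open [set x | a < f x]) ->
  measurable_fun [set: Borel X] (f : Borel X -> R).
Proof.
move=> fo; apply: (measurability _ (RGenOInfty.measurableE R)).
move=> _ [_ [a ->] <-]; rewrite setTI; apply: Borel_open.
have -> : f @^-1` `]a, +oo[ = [set x | a < f x].
  by apply/seteqP; split=> x /=; rewrite in_itv /= andbT.
exact: fo.
Qed.

Lemma Borel_measurable_continuous (R : realType) (X : ptopologicalType)
    (f : X -> R) :
  continuous f -> measurable_fun [set: Borel X] (f : Borel X -> R).
Proof.
move=> cf; apply: Borel_measurable_lsc => a.
apply: (open_comp (f := f) (D := [set r | a < r])); last exact: open_gt.
by move=> x _; exact: cf.
Qed.

Lemma integrable_indic_lty (d : measure_display) (T : measurableType d)
    (R : realType) (mu : {measure set T -> \bar R}) (A : set T) :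
  measurable A -> (mu A < +oo)%E ->
  mu.-integrable [set: T] (fun x => (\1_A x)%:E).
Proof.
move=> mA muA; apply/integrableP; split; first exact/measurable_EFinP.
under eq_integral do rewrite gee0_abs ?lee_fin//.
by rewrite integral_indic// setIT.
Qed.

Lemma integrable_ae_eq (d : measure_display) (T : measurableType d)
    (R : realType) (mu : {measure set T -> \bar R}) (f g : T -> \bar R) :
  measurable_fun [set: T] f -> ae_eq mu [set: T] f g ->
  mu.-integrable [set: T] g -> mu.-integrable [set: T] f.
Proof.
move=> mf fg /integrableP[mg goo]; apply/integrableP; split=> //.
rewrite (@ae_eq_integral _ _ _ mu _ (abse \o g)) //.
- by apply: measurableT_comp.
- by apply: measurableT_comp.
- by apply: filterS fg => x fgx /fgx /= ->.
Qed.

(** Equality almost everywhere does not transfer Borel measurability; continuity of [m] supplies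
    it. *)
Lemma L1_continuous_integrable (R : realType) (X : ptopologicalType)
    (mu : {measure set (Borel X) -> \bar R}) (m : X -> Cx R) :
  continuous m -> L1 mu m ->
  mu.-integrable [set: Borel X] (fun x => (complex.Re (m x))%:E).
Proof.
move=> cm [g [[gi _] mg]].
apply: (integrable_ae_eq _ _ gi).
  apply/measurable_EFinP; apply: Borel_measurable_continuous.
  by move=> x; apply: continuous_Re; exact: cm.
by apply: filterS mg => x /= ->.
Qed.

(** * Riemann integrable functions *)

(** [phi] itself may fail to be Borel. Its lower semicontinuous envelope [psi] is Borel, and is
    dominated by [B] times the indicator of [K]. *)
Lemma lower_envelope_integrable (R : realType) (X : ptopologicalType)
    (mu : {measure set (Borel X) -> \bar R}) (phi : X -> R) (B : R)
    (K : set X) :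
  hausdorff_space X -> radon_measure mu -> compact K ->
  (forall x, `|phi x| <= B) -> (forall x, phi x != 0 -> K x) ->
  exists psi : X -> R,
    mu.-integrable [set: Borel X] (fun x => (psi x)%:E) /\
    forall x, {for x, continuous phi} -> psi x = phi x.
Proof.
move=> hX [mufin _ _] cK phiB phiK.
(* [E x] collects the lower bounds of [phi] near [x]; its supremum is the lower limit of [phi] at
   [x], the value at [x] included. *)
pose E (x : X) := [set b | nbhs x [set z | b <= phi z]].
have E_le x : ubound (E x) (phi x).
  by move=> b /= /nbhs_singleton.
have EB x : E x (- B).
  by apply: filterE => z /=; have := phiB z; rewrite ler_norml => /andP[].
have E0 x : E x !=set0 by exists (- B).
have Eub x : has_ubound (E x) by exists (phi x).
pose psi (x : X) := sup (E x).
have psi_le x : psi x <= phi x by exact: ge_sup.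
have psiE x : {for x, continuous phi} -> psi x = phi x.
  move=> cphi; apply/eqP; rewrite eq_le psi_le /=.
  apply/ler_addgt0Pr => e e0; rewrite -lerBlDr; apply: ub_le_sup => //.
  move/cvgrPdist_lt : cphi => /(_ e e0); apply: filterS => z /=.
  by rewrite ltr_norml => /andP[_]; lra.
have clK : closed K by exact: compact_closed.
have psiK x : ~ K x -> psi x = 0.
  move=> nKx; have nphi z : ~ K z -> phi z = 0.
    by move=> nKz; apply/eqP; apply: contrapT => /negP /phiK.
  rewrite psiE ?nphi //; apply: (@near_cst_continuous _ _ 0).
  have : nbhs x (~` K) by apply: open_nbhs_nbhs; split=> //; rewrite openC.
  by apply: filterS => z /nphi.
(* A lower bound valid near [x] is also one near every point close to [x], so the sets where [psi]
   exceeds [a] are open. *)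
have mpsi : measurable_fun [set: Borel X] (psi : Borel X -> R).
  apply: Borel_measurable_lsc => a; rewrite openE => x /= /sup_gt[//|b Eb ab].
  apply: filterS (nbhs_interior Eb) => z Ez /=; apply: (lt_le_trans ab).
  exact: ub_le_sup.
exists psi; split=> //.
have mK : measurable (K : set (Borel X)) by exact: Borel_closed.
have := integrableZl measurableT B (integrable_indic_lty mK (mufin K cK)).
apply: le_integrable => //; first exact/measurable_EFinP.
move=> x _; rewrite -EFinM /= lee_fin indicE.
have [xK|xK] := boolP (x \in K); last first.
  by rewrite psiK ?normr0 //; move/negP: xK; rewrite inE.
rewrite mulr1 (le_trans _ (ler_norm B)) // ler_norml.
have := phiB x; rewrite ler_norml => /andP[_ phix].
by rewrite (le_trans (psi_le x)) // andbT; exact: ub_le_sup.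
Qed.

(** The envelopes of the real and imaginary parts form an integrable function equal to [phi] off the
    negligible set of discontinuities. *)
Lemma riemann_integrable_L1 (R : realType) (X : ptopologicalType)
    (mu : {measure set (Borel X) -> \bar R}) (phi : X -> Cx R) :
  hausdorff_space X -> radon_measure mu ->
  riemann_integrable mu phi -> L1 mu phi.
Proof.
move=> hX mur [[B phiB] cK phiN].
pose K := closure [set x | phi x != 0].
have phiK x : phi x != 0 -> K x := @subset_closure _ [set x | phi x != 0] x.
have [||u [ui uE]] := @lower_envelope_integrable R X mu
    (fun x => complex.Re (phi x)) B K hX mur cK.
- by move=> x; have := le_trans (normr_Re_le _) (phiB x); rewrite lecR.
- by move=> x r0; apply: phiK; apply: contra_neq r0 => ->.
have [||v [vi vE]] := @lower_envelope_integrable R X mu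
    (fun x => complex.Im (phi x)) B K hX mur cK.
- by move=> x; have := le_trans (normr_Im_le _) (phiB x); rewrite lecR.
- by move=> x r0; apply: phiK; apply: contra_neq r0 => ->.
exists (fun x => u x +i* v x); split; first by split.
apply: negligibleS phiN => x /=; apply: contra_not => cphi.
rewrite (uE x (continuous_Re cphi)) (vE x (continuous_Im cphi)).
by case: (phi x).
Qed.

(** The integral of [g] is controlled through the step function [h], equal to [eta] on [W] plus
    [2 * c] on [U], where [W] is an open set of finite measure around the support. *)
Lemma riemann_integrable_near_continuous (R : realType) (X : ptopologicalType)
    (mu : {measure set (Borel X) -> \bar R}) (phi : X -> Cx R) (e : R) :
  hausdorff_space X -> locally_compact [set: X] -> radon_measure mu ->
  riemann_integrable mu phi -> 0 < e ->
  exists (f : X -> Cx R) (g h : X -> R) (C : set X),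
  [/\ continuous f, continuous g, compact C,
      (forall x, f x != 0 -> C x) & (forall x, g x != 0 -> C x)] /\
  [/\ (forall x, `|phi x - f x| <= (g x)%:C), (forall x, g x <= h x),
      mu.-integrable [set: Borel X] (fun x => (h x)%:E) &
      Rintegral mu [set: Borel X] h < e].
Proof.
move=> hX lX [mufin muout _] [[B phiB] cK [N [mN muN DN]]] e0.
pose K := closure [set x | phi x != 0].
have phiK x : phi x != 0 -> K x := @subset_closure _ [set x | phi x != 0] x.
have mK : measurable (K : set (Borel X)).
  by apply: Borel_closed; exact: closed_closure.
have [W [oW KW] muW] : exists2 W : set X, open W /\ K `<=` W & (mu W < +oo)%E.
  have := mufin K cK; rewrite (muout K mK) => /ereal_inf_lt[_ [W ? <-] ?].
  by exists W.
pose c := `|B| + 1; have c0 : 0 < c by rewrite /c ltr_wpDl.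
have phic x : `|phi x| <= c%:C.
  apply: le_trans (phiB x) _; rewrite lecR /c.
  by rewrite (le_trans (ler_norm B)) // lerDl.
pose w := fine (mu W); have w0 : 0 <= w by rewrite fine_ge0.
have muWE : mu W = w%:E by rewrite fineK // ge0_fin_numE.
(* This makes [eta * w] at most [e / 2], with a positive denominator even when [w] is zero. *)
pose eta := e / 2 / (w + 1).
have eta0 : 0 < eta by rewrite !divr_gt0 // ltr_wpDl.
have [U [oU NU] muU] : exists2 U : set X, open U /\ N `<=` U &
    (mu U < (e / 2 / (2 * c))%:E)%E.
  have : (mu N < (e / 2 / (2 * c))%:E)%E by rewrite muN lte_fin !divr_gt0 // mulr_gt0.
  by rewrite (muout N mN) => /ereal_inf_lt[_ [U ? <-] ?]; exists U.
have muUE : mu U = (fine (mu U))%:E.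
  by rewrite fineK // ge0_fin_numE // (lt_trans muU) // ltry.
have /choice[C CP] : forall x : X, exists C : set X, nbhs x C /\ compact C.
  by move=> x; have [C ? []] := locally_compact_nbhs x lX; exists C.
(* [osc i] bounds the distance from [phi] to [phi i] on [V i]: the crude [2 * c] for centers in [U],
   and [eta] for the others, which are continuity points. *)
pose osc x := if x \in U then 2 * c else eta.
pose V (x : X) : set X := C x `&` (W `&`
  (if x \in U then U else [set z | `|phi z - phi x| < eta%:C])).
have [|D [chi [[DK chic chi0 chiV] [chi1 chiK]]]] :=
    @compact_partition_of_unity R _ K V hX lX cK.
  move=> x Kx; apply: filterI; first by have [] := CP x.
  apply: filterI; first by apply: open_nbhs_nbhs; split=> //; exact: KW.
  case: ifPn => xU; first by apply: open_nbhs_nbhs; split=> //; rewrite inE in xU.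
  have /cvgrPdist_lt : {for x, continuous phi}.
    apply: contrapT => /DN /NU Ux; move/negP: xU; apply; exact/mem_set.
  move=> /(_ eta%:C); rewrite ltcR => /(_ eta0).
  by apply: filterS => z; rewrite distrC.
pose h x := eta * \1_W x + 2 * c * \1_U x.
have c20 : 0 <= 2 * c by rewrite mulr_ge0 // ltW.
have h0 x : 0 <= h x by rewrite addr_ge0 // mulr_ge0 // ltW.
exists (fun z => \sum_(i <- D) (chi i z)%:C * phi i),
  (fun z => \sum_(i <- D) chi i z * osc i), h,
  (\big[setU/set0]_(i <- D) C i).
have chiD z i : i \in D -> chi i z != 0 -> (\big[setU/set0]_(i <- D) C i) z.
  by move=> iD /chiV[Cz _]; rewrite (big_fsetD1 i) //=; left.
split; split.
- apply: continuous_big; first exact: add_continuous.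
  move=> i _ z; apply: cvgM; last exact: cvg_cst.
  by apply: continuous_real_complex; exact: chic.
- apply: continuous_big; first exact: add_continuous.
  by move=> i _ z; apply: cvgM; [exact: chic|exact: cvg_cst].
- by apply: bigsetU_compact => i _; have [] := CP i.
- move=> z /eqP fz; apply: contrapT => nC; apply: fz.
  rewrite big_seq big1 // => i iD.
  have [->|/(chiD _ _ iD)//] := eqVneq (chi i z) 0.
  by rewrite rmorph0 mul0r.
- move=> z /eqP fz; apply: contrapT => nC; apply: fz.
  rewrite big_seq big1 // => i iD.
  by have [->|/(chiD _ _ iD)//] := eqVneq (chi i z) 0; rewrite mul0r.
- move=> z.
  have Sphi : (\sum_(i <- D) (chi i z)%:C) * phi z = phi z.
    have [->|pz] := eqVneq (phi z) 0; first by rewrite mulr0.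
    by rewrite -rmorph_sum chiK ?mul1r //; exact: phiK.
  rewrite -[X in X - _]Sphi mulr_suml -sumrB rmorph_sum.
  apply: (le_trans (ler_norm_sum _ _ _)); apply: ler_sum => i _.
  rewrite -mulrBr normrM normcR (ger0_norm (chi0 _ _)) rmorphM.
  have [->|/chiV[_ [_ Vz]]] := eqVneq (chi i z) 0; first by rewrite rmorph0 !mul0r.
  apply: ler_wpM2l; first by rewrite ler0c.
  move: Vz; rewrite /osc; case: ifP => _; last by move=> /ltW.
  move=> _; apply: (le_trans (ler_normB _ _)).
  by rewrite mulr_natl mulr2n rmorphD lerD.
- move=> z; apply: (@le_trans _ _ (\sum_(i <- D) chi i z * h z)); last first.
    by rewrite -mulr_suml -[leRHS]mul1r ler_wpM2r.
  (* Where [chi i z] is nonzero, [z] lies in [W], and also in [U] if the center [i] does; hence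
     [osc i] is at most [h z]. *)
  apply: ler_sum => i _.
  have [->|/chiV[_ [Wz Vz]]] := eqVneq (chi i z) 0; first by rewrite !mul0r.
  apply: ler_wpM2l => //; move: Vz; rewrite /osc /h !indicE (mem_set Wz) mulr1.
  case: ifP => _ Uz; first by rewrite (mem_set Uz) mulr1 lerDr ltW.
  by rewrite lerDl mulr_ge0.
- have := integrableD measurableT
    (integrableZl measurableT eta (integrable_indic_lty (Borel_open oW) muW))
    (integrableZl measurableT (2 * c) (integrable_indic_lty (Borel_open oU)
      (lt_trans muU (ltry _)))).
  exact: eq_integrable.
- have iW := integrable_indic_lty (Borel_open oW) muW.
  have iU := integrable_indic_lty (Borel_open oU) (lt_trans muU (ltry _)).
  rewrite RintegralD //; first last.
  + exact: (integrableZl measurableT (2 * c) iU).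
  + exact: (integrableZl measurableT eta iW).
  rewrite !RintegralZl // /Rintegral !integral_indic //;
    try exact: Borel_open.
  rewrite !setIT -/w [ltRHS](splitr e); apply: ler_ltD.
    rewrite /eta mulrAC ler_pdivrMr ?ltr_wpDl //.
    apply: ler_wpM2l; first by rewrite divr_ge0 // ltW.
    by rewrite lerDl.
  by move: muU; rewrite muUE lte_fin ltr_pdivlMr ?mulr_gt0 // mulrC.
Qed.

(** * Combination of the two approximations *)

Theorem mainTheorem8 (R : realType) (X : ptopologicalType) (Y : topologicalType)
  (p : X -> Y) (mu : {measure set (Borel X) -> \bar R})
  (A : set (Y -> Cx R)) (M : set (X -> Cx R)) :
  hausdorff_space X -> locally_compact [set: X] ->
  hausdorff_space Y -> locally_compact [set: Y] ->
  continuous p -> proper_map p ->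
  radon_measure mu ->
  dense_subalgebra_C0 A ->
  (* M is a linear subspace of C_0(X) \cap L^1(X, mu_X) *)
  M `<=` C0 (R := R) (X := X) ->
  M `<=` L1 mu ->
  M (fun _ => 0) ->
  (forall m n, M m -> M n -> M (fun x => m x + n x)) ->
  (forall (c : Cx R) m, M m -> M (fun x => c * m x)) ->
  (* M is a p^*A-module under pointwise multiplication *)
  (forall a m, A a -> M m -> M (fun x => a (p x) * m x)) ->
  (* (1) stability under complex conjugation *)
  (forall m, M m -> M (fun x => (m x)^*)) ->
  (* (2) restrictions to each fiber are dense in C(p^{-1}(y)) *)
  (forall (y : Y) (g : X -> Cx R),
     {within p @^-1` [set y], continuous g} ->
     forall e : R, 0 < e ->
     exists2 m, M m & forall x, p x = y -> `|m x - g x| <= e%:C) ->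
  (* (3) domination *)
  (forall m, M m -> exists2 n, M n & forall x, `|m x| <= n x) ->
  forall phi : X -> Cx R, riemann_integrable mu phi -> tau_closure mu M phi.
Proof.
move=> hX lX hY lY cp pp mur Ad MC0 ML1 M0 MD MZ MA MJ Mfib Mdom phi phiRI.
split; first exact: riemann_integrable_L1.
move=> e e0.
have Mi m : M m ->
    mu.-integrable [set: Borel X] (fun x => (complex.Re (m x))%:E).
  move=> Mm; apply: L1_continuous_integrable; last exact: ML1.
  by have [] := MC0 m Mm.
pose J (m : X -> Cx R) := Rintegral mu [set: Borel X] (fun x => complex.Re (m x)).
have JD m n : M m -> M n -> J (fun x => m x + n x) = J m + J n.
  move=> Mm Mn; rewrite /J -RintegralD //; [|exact: Mi|exact: Mi].
  by apply: eq_Rintegral => x _; case: (m x) (n x) => [? ?] [? ?].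
have JZ (r : R) m : M m -> J (fun x => r%:C * m x) = r * J m.
  move=> Mm; rewrite /J -RintegralZl //; last exact: Mi.
  by apply: eq_Rintegral => x _; case: (m x) => ? ? /=; rewrite mul0r subr0.
have approx (f : X -> Cx R) (K : set X) (d : R) : continuous f -> compact K ->
    (forall x, f x != 0 -> K x) -> 0 < d ->
    exists m n, [/\ M m, M n, forall x, `|f x - m x| <= n x & J n < d].
  move=> cf cK fK d0.
  have [n0 [Mn0 n0_ge0 n0P]] :=
    module_approximation hY lY cp pp Ad MC0 M0 MD MZ MA Mfib Mdom cf cK fK.
  have J_ge0 n : (forall x, 0 <= n x) -> 0 <= J n.
    move=> n_ge0; apply: Rintegral_ge0 => x _.
    by have := n_ge0 x; rewrite lecE => /andP[].
  (* Adding 1 covers the case of a zero integral and makes the second inequality strict. *)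
  have scale a : 0 <= a -> 0 < d / 2 / (a + 1) /\ d / 2 / (a + 1) * a < d / 2.
    move=> a0; have a1 : 0 < a + 1 by rewrite ltr_wpDl.
    split; first by rewrite !divr_gt0.
    by rewrite mulrAC ltr_pdivrMr // ltr_pM2l ?divr_gt0 // ltrDl.
  have [eta0 etaJ] := scale _ (J_ge0 _ n0_ge0).
  have [n1 [Mn1 n1_ge0 n1P]] := n0P _ eta0.
  have [r0 rJ] := scale _ (J_ge0 _ n1_ge0).
  have [m Mm fm] := n1P _ r0.
  (* The majorant found by unification is a combination of [n0] and [n1], each term having integral
     below [d / 2]. *)
  exists m; eexists; split; [exact: Mm| |exact: fm|].
    by apply: MD; exact: MZ.
  by rewrite JD ?JZ //; [lra|exact: MZ|exact: MZ].
(* Four terms will be added: the integral of [h], that of [k1], and twice that of [k2]. *)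
have e4 : 0 < e / 4 by rewrite divr_gt0.
have [f [g [h [C [[cf cg cC fC gC] [phif gh hi Jh]]]]]] :=
  riemann_integrable_near_continuous hX lX mur phiRI e4.
have [m1 [k1 [Mm1 Mk1 fm1 Jk1]]] := approx f C (e / 4) cf cC fC e4.
have [||m2 [k2 [Mm2 Mk2 gm2 Jk2]]] :=
    approx (fun x => (g x)%:C) C (e / 4) _ cC _ e4.
- by move=> x; apply: continuous_real_complex; exact: cg.
- by move=> x gx; apply: gC; apply: contra_neq gx => ->.
(* A majorant must be real, and [m2] need not be; stability under conjugation keeps its real part in
   [M]. *)
pose m3 x : Cx R := (complex.Re (m2 x))%:C.
have Mm3 : M m3.
  rewrite (_ : m3 = fun x => 2^-1 * (m2 x + (m2 x)^*)).
    by apply: MZ; apply: MD => //; exact: MJ.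
  by apply/funext => x; rewrite /m3 ReJ_add mulrC.
have k2E x : (complex.Re (k2 x))%:C = k2 x.
  by rewrite RRe_real // ger0_real // (le_trans _ (gm2 x)).
have gm x : `|g x - complex.Re (m2 x)| <= complex.Re (k2 x).
  rewrite -lecR k2E; apply: le_trans (gm2 x).
  by apply: le_trans (normr_Re_le _); case: (m2 x).
(* Pointwise, [m3] is at most [g + k2], hence at most [h + k2]. *)
have Jm3 : J m3 <= Rintegral mu [set: Borel X] h + J k2.
  rewrite /J -RintegralD //; last exact: Mi.
  apply: le_Rintegral => //; first exact: (Mi m3).
    exact: (integrableD measurableT hi (Mi _ Mk2)).
  move=> x _ /=; have := gm x; have := gh x.
  by rewrite ler_norml => ? /andP[]; lra.
(* [k1] bounds the distance from [f] to [m1], while [m3 + k2] bounds [g], hence the distance from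
   [phi] to [f]. *)
pose n x := k1 x + (m3 x + k2 x).
have Mn : M n by apply: (MD) => //; exact: MD.
have phin x : `|phi x - m1 x| <= n x.
  apply: (le_trans (ler_distD (f x) _ _)); rewrite addrC; apply: lerD => //.
  apply: (le_trans (phif x)); rewrite /m3 -k2E -rmorphD lecR.
  by have := gm x; rewrite ler_norml => /andP[]; lra.
exists m1, n; split=> //.
(* Since [n] dominates a modulus it is real, so [cint] reduces to [J]. *)
have nIm x : complex.Im (n x) = 0.
  by apply: ger0_Im; exact: le_trans (phin x).
have -> : cint mu n = (J n)%:C.
  rewrite /cint -/(J n) (@eq_Rintegral _ _ _ mu setT (cst 0)); last first.
    by move=> x _; exact: nIm.
  by rewrite Rintegral_cst // mul0r rmorph0 mulr0 addr0.
rewrite ltcR !JD //; last exact: MD.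
by lra.
Qed.
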